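(* Let $(U,A)$ and $(V,B)$ be intuitionistic fuzzy normed linear spaces over the same field, let $f$ be a mapping from $(U,A)$ to $(V,B)$, and let $D$ be a compact subset of $U$. If $f$ is intuitionistic fuzzy continuous on $U$, then $f(D)$ is a compact subset of $V$.
   Context: $\mathbb{R}^+=(0,\infty)$. A binary operation $\ast:[0,1]\times[0,1]\to[0,1]$ is a continuous $t$-norm if it is commutative, associative and continuous, $a\ast 1=a$ for all $a\in[0,1]$, and $a\ast b\le c\ast d$ whenever $a\le c$, $b\le d$. A binary operation $\diamond:[0,1]\times[0,1]\to[0,1]$ is a continuous $t$-co-norm if it is commutative, associative and continuous, $a\diamond 0=a$ for all $a\in[0,1]$, and $a\diamond b\le c\diamond d$ whenever $a\le c$, $b\le d$. Let $\ast$ be a continuous $t$-norm, $\diamond$ a continuous $t$-co-norm, and $V$ a linear space over the field $F=\mathbb{R}$ or $\mathbb{C}$. An intuitionistic fuzzy norm (IFN) on $V$ is an object $A=\{((x,t),N(x,t),M(x,t)) : (x,t)\in V\times\mathbb{R}^+\}$, where $N,M:V\times\mathbb{R}^+\to[0,1]$ satisfy, for all $x,y\in V$ and $s,t\in\mathbb{R}^+$: (i) $N(x,t)+M(x,t)\le 1$; (ii) $N(x,t)>0$; (iii) $N(x,t)=1$ if and only if $x=\underline{0}$ (the zero vector); (iv) $N(cx,t)=N(x,t/|c|)$ for $c\in F$, $c\ne 0$; (v) $N(x,s)\ast N(y,t)\le N(x+y,s+t)$; (vi) $N(x,\cdot)$ is a non-decreasing function on $\mathbb{R}^+$ and $\lim_{t\to\infty}N(x,t)=1$;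 (vii) $M(x,t)\ge 0$; (viii) $M(x,t)=0$ if and only if $x=\underline{0}$; (ix) $M(cx,t)=M(x,t/|c|)$ for $c\in F$, $c\ne 0$; (x) $M(x,s)\diamond M(y,t)\ge M(x+y,s+t)$; (xi) $M(x,\cdot)$ is a non-increasing function on $\mathbb{R}^+$ and $\lim_{t\to\infty}M(x,t)=0$. If $A$ is an IFN on $V$, then $(V,A)$ is called an intuitionistic fuzzy normed linear space (IFNLS). A sequence $\{x_n\}_n$ in an IFNLS $(V,A)$ converges to $x\in V$ if for every $t>0$ and every $0<r<1$ there is $n_0\in\mathbb{N}$ such that $N(x_n-x,t)>1-r$ and $M(x_n-x,t)<r$ for all $n\ge n_0$. A subset $P$ of $V$ is compact if every sequence in $P$ has a subsequence converging to an element of $P$. For IFNLSs $(U,A)$ and $(V,B)$ over the same field, write $N_U,M_U$ and $N_V,M_V$ for the corresponding functions of $A$ and $B$. A mapping $f:U\to V$ is intuitionistic fuzzy continuous at $x_0\in U$ if for every $\varepsilon>0$ and $\alpha\in(0,1)$ there exist $\delta=\delta(\alpha,\varepsilon)>0$ and $\beta=\beta(\alpha,\varepsilon)\in(0,1)$ such that for all $x\in U$: $N_U(x-x_0,\delta)>\beta$ implies $N_V(f(x)-f(x_0),\varepsilon)>\alpha$, and $M_U(x-x_0,\delta)<1-\beta$ implies $M_V(f(x)-f(x_0),\varepsilon)<1-\alpha$; it is intuitionistic fuzzy continuous on $U$ if it is so at each point of $U$. *)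

(* Defs.v *)
From HB Require Import structures.
From mathcomp Require Import all_boot all_order all_algebra.
From mathcomp Require Import all_classical all_reals all_analysis.
From mathcomp Require Import complex.

Set Implicit Arguments.
Unset Strict Implicit.
Unset Printing Implicit Defensive.

Import Order.TTheory GRing.Theory Num.Theory.
Import numFieldNormedType.Exports.

Local Open Scope classical_set_scope.
Local Open Scope ring_scope.

Variant scalar_kind := RealScalars | ComplexScalars.

Definition scalars (R : realType) (k : scalar_kind) : fieldType :=
  match k with
  | RealScalars => R
  | ComplexScalars => R[i]
  end.

(* The absolute value of a scalar as an element of R; the MathComp norm of a
   z : R[i] is an element of R[i]. *)
Definition absF (R : realType) (k : scalar_kind) : scalars R k -> R :=
  match k return scalars R k -> R with
  | RealScalars => fun c : R => `|c|
  | ComplexScalars => fun c : R[i] => ComplexField.Normc.normc c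
  end.

(* Operations on [0, 1] are functions on R of which only the restriction to
   [0, 1] x [0, 1] is constrained. *)
Record continuous_binop01 (R : realType) (op : R -> R -> R) (e : R) : Prop := {
  op01_closed : forall a b : R, 0 <= a <= 1 -> 0 <= b <= 1 -> 0 <= op a b <= 1;
  op01_comm : forall a b : R, 0 <= a <= 1 -> 0 <= b <= 1 -> op a b = op b a;
  op01_assoc : forall a b c : R, 0 <= a <= 1 -> 0 <= b <= 1 -> 0 <= c <= 1 ->
    op a (op b c) = op (op a b) c;
  op01_continuous :
    {within `[0, 1] `*` `[0, 1], continuous (fun p : R * R => op p.1 p.2)};
  op01_unit : forall a : R, 0 <= a <= 1 -> op a e = a;
  op01_mono : forall a b c d : R,
    0 <= a <= 1 -> 0 <= b <= 1 -> 0 <= c <= 1 -> 0 <= d <= 1 ->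
    a <= c -> b <= d -> op a b <= op c d }.

Definition continuous_tnorm (R : realType) (op : R -> R -> R) : Prop :=
  continuous_binop01 op 1.

Definition continuous_tconorm (R : realType) (op : R -> R -> R) : Prop :=
  continuous_binop01 op 0.

(* N and M are functions on V x (0, +oo): their values at t <= 0 are
   unconstrained and never used. *)
Record is_IFN (R : realType) (k : scalar_kind) (V : lmodType (scalars R k))
    (tn tc : R -> R -> R) (N M : V -> R -> R) : Prop := {
  IFN_N01 : forall (x : V) (t : R), 0 < t -> 0 <= N x t <= 1;
  IFN_M01 : forall (x : V) (t : R), 0 < t -> 0 <= M x t <= 1;
  IFN_sum_le1 : forall (x : V) (t : R), 0 < t -> N x t + M x t <= 1;
  IFN_N_gt0 : forall (x : V) (t : R), 0 < t -> 0 < N x t;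
  IFN_N_eq1 : forall (x : V) (t : R), 0 < t -> (N x t = 1 <-> x = 0);
  IFN_N_scale : forall (c : scalars R k) (x : V) (t : R), c != 0 -> 0 < t ->
    N (c *: x) t = N x (t / absF c);
  IFN_N_add : forall (x y : V) (s t : R), 0 < s -> 0 < t ->
    tn (N x s) (N y t) <= N (x + y) (s + t);
  IFN_N_mono : forall (x : V) (s t : R), 0 < s -> s <= t -> N x s <= N x t;
  IFN_N_lim : forall x : V, N x t @[t --> +oo] --> (1 : R);
  IFN_M_ge0 : forall (x : V) (t : R), 0 < t -> 0 <= M x t;
  IFN_M_eq0 : forall (x : V) (t : R), 0 < t -> (M x t = 0 <-> x = 0);
  IFN_M_scale : forall (c : scalars R k) (x : V) (t : R), c != 0 -> 0 < t ->
    M (c *: x) t = M x (t / absF c);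
  IFN_M_add : forall (x y : V) (s t : R), 0 < s -> 0 < t ->
    M (x + y) (s + t) <= tc (M x s) (M y t);
  IFN_M_mono : forall (x : V) (s t : R), 0 < s -> s <= t -> M x t <= M x s;
  IFN_M_lim : forall x : V, M x t @[t --> +oo] --> (0 : R) }.

(* The t-norm and t-co-norm belong to the data, so two intuitionistic fuzzy
   norms may be taken with respect to different ones. *)
Record IFN (R : realType) (k : scalar_kind) (V : lmodType (scalars R k)) := {
  tnorm : R -> R -> R;
  tconorm : R -> R -> R;
  Nf : V -> R -> R;
  Mf : V -> R -> R;
  tnormP : continuous_tnorm tnorm;
  tconormP : continuous_tconorm tconorm;
  IFNP : is_IFN tnorm tconorm Nf Mf }.

Definition if_converges (R : realType) (k : scalar_kind)
    (V : lmodType (scalars R k)) (A : IFN V)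
    (x_ : nat -> V) (x : V) : Prop :=
  forall t r : R, 0 < t -> 0 < r -> r < 1 ->
  exists n0 : nat, forall n : nat, (n0 <= n)%N ->
    1 - r < Nf A (x_ n - x) t /\ Mf A (x_ n - x) t < r.

Definition if_compact (R : realType) (k : scalar_kind)
    (V : lmodType (scalars R k)) (A : IFN V)
    (P : set V) : Prop :=
  forall x_ : nat -> V, (forall n, P (x_ n)) ->
  exists phi : nat -> nat, {homo phi : m n / (m < n)%N} /\
    exists2 x : V, P x & if_converges A (x_ \o phi) x.

Definition if_continuous_at (R : realType) (k : scalar_kind)
    (U V : lmodType (scalars R k))
    (A : IFN U) (B : IFN V) (f : U -> V) (x0 : U) : Prop :=
  forall eps alpha : R, 0 < eps -> 0 < alpha -> alpha < 1 ->
  exists delta beta : R, [/\ 0 < delta, 0 < beta, beta < 1 &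
    forall x : U,
      (beta < Nf A (x - x0) delta -> alpha < Nf B (f x - f x0) eps) /\
      (Mf A (x - x0) delta < 1 - beta -> Mf B (f x - f x0) eps < 1 - alpha)].

Definition if_continuous (R : realType) (k : scalar_kind)
    (U V : lmodType (scalars R k))
    (A : IFN U) (B : IFN V) (f : U -> V) : Prop :=
  forall x0 : U, if_continuous_at A B f x0.

(* Main.v *)
Require Import Defs.
From mathcomp Require Import all_boot all_order all_algebra.
From mathcomp Require Import all_classical all_reals all_analysis.
From mathcomp Require Import lra.

Local Open Scope classical_set_scope.
Local Open Scope ring_scope.

(** Continuity at a point preserves sequential convergence ([if_continuous_at_converges]). Preimages
    in [D] of a sequence in the image have a subsequence converging in [D]; applying [f] to it gives
    a convergent subsequence of the original sequence. *)

Lemma if_continuous_at_converges (R : realType) (k : scalar_kind)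
    (U V : lmodType (scalars R k)) (A : IFN U) (B : IFN V)
    (f : U -> V) (u : nat -> U) (x : U) :
  if_continuous_at A B f x -> if_converges A u x ->
  if_converges B (f \o u) (f x).
Proof.
move=> cf ux t r t0 r0 r1.
(* The level [1 - r] serves both bounds, since [1 - (1 - r) = r]; likewise the radius [1 - b] below
   yields [b < Nf] and [Mf < 1 - b]. *)
have [|| d [b [d0 b0 b1 fdb]]] := cf t (1 - r) t0; [lra | lra |].
have [|| n0 un0] := ux d (1 - b) d0; [lra | lra |].
exists n0 => n /un0[Nn Mn].
have [fN fM] := fdb (u n).
rewrite /=; split; first by apply: fN; lra.
by have := fM Mn; lra.
Qed.

Theorem theorem14 (R : realType) (k : scalar_kind)
    (U V : lmodType (scalars R k)) (A : IFN U) (B : IFN V)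
    (f : U -> V) (D : set U) :
  if_compact A D -> if_continuous A B f -> if_compact B (f @` D).
Proof.
move=> cptD cf y Dy.
have /choice[u Du] : forall n, exists x, D x /\ f x = y n.
  by move=> n; have [x Dx fx] := Dy n; exists x.
have [phi [phi_incr [x Dx ux]]] := cptD u (fun n => (Du n).1).
exists phi; split=> //; exists (f x); first by exists x.
(* Now [y \o phi] is [f \o (u \o phi)] up to conversion. *)
have -> : y = f \o u by apply/funext => n; rewrite /= (Du n).2.
exact: if_continuous_at_converges (cf x) ux.
Qed.
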